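(* Let $\Upsilon$ be a finite purely relational vocabulary, and let $X$ be an infinite connected $\Upsilon$-structure of bounded degree that has the duplicate substructure property. Then for every first-order $\Upsilon$-sentence $\phi$, either $\phi$ is almost surely true for finite substructures of $X$, or $\phi$ is almost surely false for finite substructures of $X$.
   Context: Structures are $\Upsilon$-structures and sentences are first-order $\Upsilon$-sentences. A substructure of $X$ is the induced substructure on a subset of its elements (the empty subset is allowed). The Gaifman graph $[X]$ has the elements of $X$ as vertices, with an undirected edge between distinct $x,y$ whenever there are $R\in\Upsilon$ and $z_1,\ldots,z_\ell\in X$ with $R(z_1,\ldots,z_\ell)$ true in $X$ and $x,y\in\{z_1,\ldots,z_\ell\}$. The structure $X$ is connected if $[X]$ has exactly one connected component; it has bounded degree if the vertex degrees of $[X]$ are finite and uniformly bounded. The distance $d(x,y)$ is the length of a shortest path from $x$ to $y$ in $[X]$ ($\infty$ if there is none), and $B_n(x)$ is the substructure of $X$ supported by the elements at distance at most $n$ from $x$. Two substructures of $X$ are disjoint if they have no common element and there are no edges of $[X]$ between them. $X$ has the duplicate substructure property if for every finite substructure of $X$ there is an isomorphic substructure of $X$ disjoint from it. A sentence is almost surely true (resp. almost surely false) for finite substructures of $X$ if for every $x\in X$ the fraction of substructures of $B_n(x)$ (i.e. of subsets of its element set) for which the sentence is true approaches $1$ (resp. $0$) as $n\to\infty$. *)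

(* Defs.v *)
From HB Require Import structures.
From mathcomp Require Import all_boot all_order all_algebra finmap.
From mathcomp Require Import all_classical all_reals all_analysis.
Set Implicit Arguments.
Unset Strict Implicit.
Unset Printing Implicit Defensive.
Import Order.TTheory GRing.Theory Num.Theory.
Import numFieldNormedType.Exports.
Local Open Scope classical_set_scope.
Local Open Scope ring_scope.

Record vocabulary := Vocabulary {
  symbol :> finType;
  arity : symbol -> nat }.

Record structure (Y : vocabulary) := Structure {
  carrier :> Type;
  interp : forall r : Y, set ('I_(arity r) -> carrier) }.

(* Formulas in a context of n free variables, named by de Bruijn index: under
   a quantifier, index 0 is the bound variable and the others are shifted. *)
Inductive formula (Y : vocabulary) : nat -> Type :=
| FEq n of 'I_n & 'I_n : formula Y n
| FRel n (r : Y) of ('I_(arity r) -> 'I_n) : formula Y n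
| FNot n of formula Y n : formula Y n
| FAnd n of formula Y n & formula Y n : formula Y n
| FOr n of formula Y n & formula Y n : formula Y n
| FImp n of formula Y n & formula Y n : formula Y n
| FAll n of formula Y n.+1 : formula Y n
| FEx n of formula Y n.+1 : formula Y n.

Arguments FEq {Y n} i j : rename.
Arguments FRel {Y n} r v : rename.

Definition sentence (Y : vocabulary) := formula Y 0.

Definition env_cons (A : Type) n (a : A) (e : 'I_n -> A) : 'I_n.+1 -> A :=
  fun i => oapp e a (unlift ord0 i).

Fixpoint holds (Y : vocabulary) (X : structure Y) n (f : formula Y n) :
    ('I_n -> X) -> Prop :=
  match f with
  | FEq _ i j => fun e => e i = e j
  | FRel _ r v => fun e => interp (e \o v)
  | FNot _ f1 => fun e => ~ holds f1 e
  | FAnd _ f1 f2 => fun e => holds f1 e /\ holds f2 e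
  | FOr _ f1 f2 => fun e => holds f1 e \/ holds f2 e
  | FImp _ f1 f2 => fun e => holds f1 e -> holds f2 e
  | FAll _ f1 => fun e => forall a : X, holds f1 (env_cons a e)
  | FEx _ f1 => fun e => exists a : X, holds f1 (env_cons a e)
  end.

Definition no_var (A : Type) : 'I_0 -> A :=
  fun i => False_rect A (notF (ltn_ord i)).

Definition models (Y : vocabulary) (X : structure Y) (phi : sentence Y) : Prop :=
  holds phi (no_var X).

Definition isomorphic (Y : vocabulary) (A B : structure Y) : Prop :=
  exists2 f : A -> B, bijective f &
    forall (r : Y) (z : 'I_(arity r) -> A), interp z <-> interp (f \o z).

Section Gaifman.
Variables (Y : vocabulary) (X : structure Y).

Definition substructure (S : set X) : structure Y :=
  @Structure Y S (fun r z => interp (fun i => val (z i))).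

Definition gaifman (x y : X) : Prop :=
  x <> y /\ exists (r : Y) (z : 'I_(arity r) -> X),
    [/\ interp z, range z x & range z y].

Definition walk (x y : X) (n : nat) : Prop :=
  exists p : seq X,
    [/\ path (fun a b => `[< gaifman a b >]) x p, last x p = y & size p = n].

Definition component (x : X) : set X := [set y | exists n, walk x y n].

Definition connected_structure : Prop :=
  exists C : set X, range component = [set C].

Definition bounded_degree : Prop :=
  exists D : nat, forall x : X, ([set y | gaifman x y] #<= `I_D)%card.

Lemma walk_asbool (x y : X) :
  (exists n, walk x y n) -> exists n, `[< walk x y n >].
Proof. by move=> [n w]; exists n; apply/asboolP. Qed.

(* [None] stands for infinite distance. *)
Definition distance (x y : X) : option nat :=
  if pselect (exists n, walk x y n) is left w
  then Some (ex_minn (walk_asbool w)) else None.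

Definition gball (n : nat) (x : X) : set X :=
  [set y | if distance x y is Some d then (d <= n)%N else False].

Definition disjoint_substructures (S T : set X) : Prop :=
  S `&` T = set0 /\ forall x y, S x -> T y -> ~ gaifman x y.

Definition duplicate_substructure : Prop :=
  forall S : set X, finite_set S ->
    exists T : set X, isomorphic (substructure S) (substructure T) /\
      disjoint_substructures S T.

(* [fset_set] returns the empty finite set on infinite sets; when the degree is
   bounded, balls are finite, so both sets below are finite. *)
Definition true_fraction (R : realType) (phi : sentence Y) (B : set X) : R :=
  #|` fset_set [set S : set X | S `<=` B /\ models (substructure S) phi]|%:R /
  #|` fset_set [set S : set X | S `<=` B]|%:R.

Definition almost_surely_true (R : realType) (phi : sentence Y) : Prop :=
  forall x : X, true_fraction R phi (gball n x) @[n --> \oo] --> (1 : R).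

Definition almost_surely_false (R : realType) (phi : sentence Y) : Prop :=
  forall x : X, true_fraction R phi (gball n x) @[n --> \oo] --> (0 : R).

End Gaifman.

(* Main.v *)
(* Call [S] rich for a finite index type [I] if every [I]-indexed tuple of
   elements of [X] has a copy in [S] that is isolated, i.e. a union of connected
   components of the Gaifman graph of [S].  Two sets rich for large enough [I]
   satisfy the same sentences of given quantifier depth, by an
   Ehrenfeucht-Fraisse game in which isomorphic neighbourhoods of the pebbles
   are maintained: a new pebble near the old ones is answered by the current
   isomorphism, and a new pebble far from them by an isolated copy of its ball
   (a finite set, as degrees are bounded) that avoids the old pebbles.
   A random subset of a large ball is rich: the duplicate substructure property
   yields arbitrarily many copies of a given tuple with pairwise disjoint closed
   neighbourhoods, and the events that the random set meets such a neighbourhood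
   exactly in the copy are independent, with probabilities bounded below. *)
Require Import Defs.
From mathcomp Require Import all_boot all_order all_algebra finmap.
From mathcomp Require Import all_classical all_reals all_analysis.
Set Implicit Arguments.
Unset Strict Implicit.
Unset Printing Implicit Defensive.
Import Order.TTheory GRing.Theory Num.Theory.
Import numFieldNormedType.Exports.
Local Open Scope classical_set_scope.

(** * Sets with at most a given number of elements *)

Section BoundedSets.
Variable T : Type.
Implicit Types (A B : set T) (m n : nat).

(** The list may repeat entries or leave [A], so explicit bounds propagate easily; [{classic T}]
    gives the bare type [T] a decidable equality. *)
Definition bounded_by A n := exists s : seq {classic T},
  (size s <= n)%N /\ forall x, A x -> (x : {classic T}) \in s.

Lemma bounded_by_sub A B n : A `<=` B -> bounded_by B n -> bounded_by A n.
Proof. by move=> AB [s [sn sB]]; exists s; split=> // x /AB /sB. Qed.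

Lemma bounded_by_leq A m n : (m <= n)%N -> bounded_by A m -> bounded_by A n.
Proof. by move=> mn [s [sm sA]]; exists s; split=> //; apply: leq_trans mn. Qed.

Lemma bounded_by_range (I : finType) (h : I -> T) : bounded_by (range h) #|I|.
Proof.
pose g : I -> {classic T} := h.
exists (map g (enum I)); split; first by rewrite size_map -cardE.
by move=> _ [i _ <-]; apply: (map_f g); rewrite mem_enum.
Qed.

Lemma bounded_by_bigcup (F : T -> set T) A m n : bounded_by A m ->
  (forall x, bounded_by (F x) n) ->
  bounded_by [set y | exists2 x, A x & F x y] (m * n).
Proof.
move=> [s [sm sA]] /choice [t tF].
exists (flatten [seq (t x : seq {classic T}) | x <- s]); split.
  rewrite size_flatten /shape -map_comp sumnE big_map.
  apply: leq_trans (leq_mul sm (leqnn n)).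
  rewrite -[size s]sum1_size big_distrl /= leq_sum // => x _.
  by rewrite mul1n (tF x).1.
move=> y [x Ax Fxy]; apply/flattenP; exists (t x : seq {classic T}).
  by apply: (map_f (t : {classic T} -> _)); exact: sA.
exact: (tF x).2.
Qed.

Lemma bounded_by_finite A n : bounded_by A n -> finite_set A.
Proof.
by move=> [s [_ sA]]; apply: (@sub_finite_set _ _ [set` s]) => //=.
Qed.

Lemma finite_bounded_by A : finite_set A -> exists n, bounded_by A n.
Proof.
move=> /(@finite_seqP {classic T}) [s ->].
by exists (size s); exists s.
Qed.

Lemma bounded_by_enum A n x : bounded_by A n -> A x ->
  exists h : 'I_n -> T, range h = A.
Proof.
move=> [s [sn sA]] Ax.
pose t : seq {classic T} := [seq y <- s | `[< A y >]].
have tn : (size t <= n)%N by rewrite (leq_trans _ sn) // size_filter count_size.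
exists (fun i : 'I_n => nth (x : {classic T}) t i); apply/seteqP; split.
  move=> _ [i _ <-]; have [it|it] := ltnP i (size t); last by rewrite nth_default.
  by have := mem_nth (x : {classic T}) it; rewrite mem_filter => /andP[/asboolP].
move=> y Ay; have yt : (y : {classic T}) \in t.
  by rewrite mem_filter sA // andbT; apply/asboolP.
have iy : (index (y : {classic T}) t < n)%N by rewrite (leq_trans _ tn) // index_mem.
by exists (Ordinal iy) => //=; rewrite nth_index.
Qed.

(** Pigeonhole: if each of the [n.+1] disjoint sets met [A], a choice of meeting points would inject
    ['I_n.+1] into the positions of a list of length at most [n]. *)
Lemma bounded_by_avoid A n (F : 'I_n.+1 -> set T) : bounded_by A n ->
  (forall u v x, F u x -> F v x -> u = v) -> exists u, forall x, F u x -> ~ A x.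
Proof.
move=> [s [sn sA]] Finj; apply: contrapT => /forallNP noF.
have /choice [g gF] : forall u, exists x, F u x /\ A x.
  move=> u; apply: contrapT => nex; apply: (noF u) => x Fx Ax.
  by apply: nex; exists x.
have gs u : (index (g u : {classic T}) s < n)%N.
  by rewrite (leq_trans _ sn) // index_mem sA //; have [] := gF u.
pose k u := Ordinal (gs u).
have kinj : injective k.
  move=> u v /(congr1 val) /= /(congr1 (nth (g u : {classic T}) s)).
  have [Fu Au] := gF u; have [Fv Av] := gF v.
  rewrite !nth_index; [|exact: sA..] => guv.
  by apply: (Finj u v (g u)) => //; rewrite guv.
by have := leq_card k kinj; rewrite !card_ord ltnn.
Qed.

End BoundedSets.

(** * Neighbourhoods, partial isomorphisms and isolated copies *)

Section LocalIsomorphisms.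
Variables (Y : vocabulary) (X : structure Y).
Implicit Types (S A B : set X) (P : X -> X -> Prop) (I : finType).

(** Adjacency in the Gaifman graph of the substructure on [S], with loops allowed. The whole
    witnessing tuple must lie in [S], so this can be finer than the graph of [X] restricted to
    [S]. *)
Definition adjacent_in S (x y : X) := exists (r : Y) (z : 'I_(arity r) -> X),
  [/\ interp z, (forall i, S (z i)), range z x & range z y].

Definition nb S A : set X := A `|` [set y | exists2 x, A x & adjacent_in S x y].

Definition nbs S n A := iter n (nb S) A.

Lemma adjacent_in_sym S x y : adjacent_in S x y -> adjacent_in S y x.
Proof. by move=> [r [z [? ? ? ?]]]; exists r, z. Qed.

Lemma adjacent_in_mem S x y : adjacent_in S x y -> S y.
Proof. by move=> [r [z [? Sz ? [i _ <-]]]]; apply: Sz. Qed.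

Lemma adjacent_in_setT S x y : adjacent_in S x y -> adjacent_in setT x y.
Proof. by move=> [r [z [? ? ? ?]]]; exists r, z. Qed.

Lemma nb_mono S A B : A `<=` B -> nb S A `<=` nb S B.
Proof.
by move=> AB y [/AB|[x /AB Bx xy]]; [left|right; exists x].
Qed.

Lemma nbs_mono S n A B : A `<=` B -> nbs S n A `<=` nbs S n B.
Proof. by move=> AB; elim: n => //= n IH; apply: nb_mono. Qed.

Lemma nbs_extensive S n A : A `<=` nbs S n A.
Proof. by elim: n => //= n IH x /IH; left. Qed.

Lemma nbsD S m n A : nbs S (m + n) A = nbs S m (nbs S n A).
Proof. exact: iterD. Qed.

Lemma nbs_leq S m n A : (m <= n)%N -> nbs S m A `<=` nbs S n A.
Proof. by move=> /subnK <-; rewrite nbsD; apply: nbs_extensive. Qed.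

Lemma nbs_subset S n A : A `<=` S -> nbs S n A `<=` S.
Proof.
move=> AS; elim: n => //= n IH x [/IH //|[y _]]; exact: adjacent_in_mem.
Qed.

Lemma nbsU S n A B : nbs S n (A `|` B) = nbs S n A `|` nbs S n B.
Proof.
elim: n => //= n ->; apply/seteqP; split=> y.
  move=> [[Ay|By]|[x [Ax|Bx] xy]]; [left; left|right; left|left; right|right; right] => //.
    by exists x.
  by exists x.
move=> [[Ay|[x Ax xy]]|[By|[x Bx xy]]]; [left; left|right|left; right|right] => //.
  by exists x => //; left.
by exists x => //; right.
Qed.

Lemma nbs0 S n : nbs S n set0 = set0.
Proof.
by elim: n => //= n ->; rewrite -subset0 => x [//|[y]].
Qed.

Lemma nbs_sym S n x y : nbs S n [set x] y -> nbs S n [set y] x.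
Proof.
elim: n y => [|n IH] y /=; first by move=> ->.
move=> [/IH|[w /IH xw wy]]; first by left.
suff : nbs S n (nb S [set y]) x by rewrite /nbs -iterSr.
apply: nbs_mono xw => _ ->; by right; exists y => //; apply: adjacent_in_sym.
Qed.

(** A relation instead of a partial function, so that the inverse is [flip P] and the back and forth
    directions share one proof. *)
Definition partial_iso P := [/\ (forall x y y', P x y -> P x y' -> y = y'),
  (forall x x' y, P x y -> P x' y -> x = x') &
  forall (r : Y) (z z' : 'I_(arity r) -> X),
    (forall i, P (z i) (z' i)) -> interp z <-> interp z'].

Definition dom P : set X := [set x | exists y, P x y].
Definition flip P : X -> X -> Prop := fun x y => P y x.

Lemma partial_iso_flip P : partial_iso P -> partial_iso (flip P).
Proof.
move=> [P1 P2 P3]; split=> [x y y'|x x' y|r z z' zz']; [exact: P2|exact: P1|].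
by apply: iff_sym; apply: P3.
Qed.

(** All entries of a tuple witnessing adjacency to a point of [A] lie in [nb S A], hence in [dom P];
    so [P] carries the entire tuple into [S'], where it witnesses the matching adjacency. *)
Lemma nb_matches P S S' A B : partial_iso P -> dom (flip P) `<=` S' ->
  nb S A `<=` dom P -> (forall x, A x -> exists2 y, B y & P x y) ->
  forall x, nb S A x -> exists2 y, nb S' B y & P x y.
Proof.
move=> [P1 P2 P3] dS' dA AB x [/AB [y By Pxy]|]; first by exists y => //; left.
move=> [w Aw [r [z [zr Sz [i0 _ zi0] [i1 _ zi1]]]]].
have /choice [z' Pz] : forall i, exists y, P (z i) y.
  move=> i; apply: dA; right; exists w => //.
  by exists r, z; split=> //; exists i0.
exists (z' i1); last by rewrite -zi1.
right; exists (z' i0).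
  have [y By Pwy] := AB _ Aw.
  by rewrite (P1 w (z' i0) y) // -zi0.
exists r, z'; split; [exact/(P3 _ _ _ Pz)| |by exists i0|by exists i1].
by move=> i; apply: dS'; exists (z i); apply: Pz.
Qed.

Lemma nbs_matches P S S' A B n : partial_iso P ->
  dom P `<=` S -> dom (flip P) `<=` S' ->
  nbs S n A `<=` dom P -> nbs S' n B `<=` dom (flip P) ->
  (forall x, A x -> exists2 y, B y & P x y) ->
  (forall y, B y -> exists2 x, A x & P x y) ->
  (forall x, nbs S n A x -> exists2 y, nbs S' n B y & P x y) /\
  (forall y, nbs S' n B y -> exists2 x, nbs S n A x & P x y).
Proof.
move=> isoP dS dS' + + AB BA; elim: n => [//|n IH] dA dB.
have [||IH1 IH2] := IH.
- by apply: subset_trans dA => x; left.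
- by apply: subset_trans dB => x; left.
split; first exact: nb_matches.
apply: (@nb_matches (flip P)) => //.
exact: partial_iso_flip.
Qed.

(** Equality of atomic types; repeated entries are allowed, so one index type serves all sets of
    bounded size. *)
Definition alike I (h h' : I -> X) :=
  (forall i j, h i = h j <-> h' i = h' j) /\
  forall (r : Y) (w : 'I_(arity r) -> I), interp (h \o w) <-> interp (h' \o w).

Lemma alike_trans I (h1 h2 h3 : I -> X) :
  alike h1 h2 -> alike h2 h3 -> alike h1 h3.
Proof.
by move=> [p q] [p' q']; split=> *; [rewrite p p'|rewrite q q'].
Qed.

Lemma alike_comp I (J : finType) (f : J -> I) (h h' : I -> X) :
  alike h h' -> alike (h \o f) (h' \o f).
Proof. by move=> [p q]; split=> [i j|r w]; [exact: p|exact: (q r (f \o w))]. Qed.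

Definition graph I (h h' : I -> X) : X -> X -> Prop :=
  fun x y => exists i, x = h i /\ y = h' i.

Lemma alike_partial_iso I (h h' : I -> X) :
  alike h h' -> partial_iso (graph h h').
Proof.
move=> [p q]; split=> [_ y y' [i [-> ->]] [j [/p ij ->]] //||r z z' /choice [w zw]].
  by move=> x x' _ [i [-> ->]] [j [-> /p ij]].
have -> : z = h \o w by apply/funext => i; exact: (zw i).1.
have -> : z' = h' \o w by apply/funext => i; exact: (zw i).2.
exact: q.
Qed.

Definition isolated_in S A := forall x y, A x -> adjacent_in S x y -> A y.

Definition rich I S := forall h : I -> X, exists h' : I -> X,
  [/\ alike h h', range h' `<=` S & isolated_in S (range h')].

Lemma isolated_nbs S A n : isolated_in S A -> nbs S n A `<=` A.
Proof. by move=> iA; elim: n => //= n IH x [/IH //|[y /IH Ay /(iA _ _ Ay)]]. Qed.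

End LocalIsomorphisms.

(** * Separated copies of a tuple from the duplicate substructure property *)

Section Copies.
Variables (Y : vocabulary) (X : structure Y) (D : nat).
Hypothesis degree_le : forall x : X, bounded_by [set y | gaifman x y] D.
Implicit Types (S A E : set X) (I : finType).

Lemma adjacent_in_bounded S (x : X) : bounded_by [set y | y = x \/ adjacent_in S x y] D.+1.
Proof.
have [s [sD sx]] := degree_le x; exists ((x : {classic X}) :: s); split=> // y xy.
rewrite inE; case: eqVneq => //= /eqP yx; apply: sx.
case: xy => // -[r [z [zr Sz zx zy]]].
by split; [move/esym|exists r, z].
Qed.

Lemma nb_bounded S A m : bounded_by A m -> bounded_by (nb S A) (m * D.+1).
Proof.
move=> /bounded_by_bigcup/(_ (adjacent_in_bounded S)); apply: bounded_by_sub => y.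
by move=> [Ay|[x Ax xy]]; [exists y => //; left|exists x => //; right].
Qed.

Lemma nbs_bounded S A m r : bounded_by A m -> bounded_by (nbs S r A) (m * D.+1 ^ r).
Proof.
move=> Am; elim: r => [|r IH]; first by rewrite muln1.
by rewrite expnSr mulnA; apply: nb_bounded.
Qed.

Lemma nb_finite S A : finite_set A -> finite_set (nb S A).
Proof. by move=> /finite_bounded_by[m /(@nb_bounded S) /bounded_by_finite]. Qed.

Hypothesis dup : duplicate_substructure X.

(** Duplicating [range h] alone would only avoid [range h]. Duplicating [E] together with [range h]
    gives a copy disjoint from both, which is then restricted to the tuple. *)
Lemma alike_avoiding I (h : I -> X) E : finite_set E ->
  exists h', alike h h' /\ forall i, ~ E (h' i).
Proof.
move=> Efin; pose U := E `|` range h.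
have [|T [[f fbij fr] [TU _]]] := dup (S := U).
  by rewrite /U finite_setU; split=> //; exact: bounded_by_finite (bounded_by_range h).
have Uh i : U (h i) by right; exists i.
pose h0 i : substructure U := SigSub (mem_set (Uh i)).
exists (fun i => val (f (h0 i))); split; last first.
  move=> i Ei; have : (U `&` T) (val (f (h0 i))).
    by split; [left|exact: set_valP].
  by rewrite TU.
split=> [i j|r w]; last exact: (fr r (h0 \o w)).
split=> [hij|/val_inj /(bij_inj fbij) /(congr1 val) //].
by congr (val (f _)); apply: val_inj.
Qed.

(** Greedy choice: each copy avoids the finite set of points within two steps of an earlier copy, so
    the closed one-step neighbourhoods are disjoint. *)
Lemma alike_copies I (h : I -> X) : exists H : nat -> I -> X,
  (forall n, alike h (H n)) /\
  forall m n x, nb setT (range (H m)) x -> nb setT (range (H n)) x -> m = n.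
Proof.
have /choice [G GP] : forall E, exists h', alike h h' /\
    (finite_set E -> forall i, ~ E (h' i)).
  move=> E; have [/(alike_avoiding h)[h' [? ?]]|nE] := pselect (finite_set E).
    by exists h'.
  by exists h; split.
pose used n := iter n (fun E => E `|` nb setT (nb setT (range (G E)))) set0.
have used_finite n : finite_set (used n).
  elim: n => [|n IH]; first exact: finite_set0.
  rewrite /used iterS -/(used n) finite_setU; split=> //.
  by do 2![apply: nb_finite]; exact: bounded_by_finite (bounded_by_range _).
have used_leq m n : (m <= n)%N -> used m `<=` used n.
  by move=> /subnK <-; elim: (n - m)%N => //= p IH x /IH; left.
have used_lt m n x : (m < n)%N -> nb setT (range (G (used m))) x ->
    nb setT (range (G (used n))) x -> False.
  move=> mn mx nx; suff [y [i _ <-]] : exists2 y, range (G (used n)) y & used n y.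
    exact: (GP (used n)).2.
  have mX y : nb setT (nb setT (range (G (used m)))) y -> used n y.
    by move=> ?; apply: (used_leq _ _ mn); right.
  case: nx => [nx|[y ny yx]]; first by exists x => //; apply: mX; left.
  by exists y => //; apply: mX; right; exists x => //; apply: adjacent_in_sym.
exists (fun n => G (used n)); split=> [n|m n x mx nx]; first exact: (GP _).1.
by case: (ltngtP m n) => // mn; case: (used_lt _ _ x mn).
Qed.

End Copies.

(** * One round of the Ehrenfeucht-Fraisse game *)

Section Game.
Variables (Y : vocabulary) (X : structure Y) (D : nat).
Hypothesis degree_le : forall x : X, bounded_by [set y | gaifman x y] D.
Hypothesis dup : duplicate_substructure X.
Implicit Types (S A : set X) (P : X -> X -> Prop).

Definition local_iso r S S' n (e e' : 'I_n -> X) := exists P,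
  [/\ partial_iso P, dom P `<=` S /\ dom (flip P) `<=` S',
      (forall i, P (e i) (e' i)), nbs S r (range e) `<=` dom P &
      nbs S' r (range e') `<=` dom (flip P)].

Lemma local_iso_sym r S S' n (e e' : 'I_n -> X) :
  local_iso r S S' e e' -> local_iso r S' S e' e.
Proof.
move=> [P [isoP [dS dS'] Pe eP e'P]]; exists (flip P).
by split=> //; exact: partial_iso_flip.
Qed.

Lemma range_env_cons n (a : X) (e : 'I_n -> X) :
  range (env_cons a e) = [set a] `|` range e.
Proof.
apply/seteqP; split=> x.
  move=> [i _ <-]; rewrite /env_cons; case: unliftP => [j _|_]; last by left.
  by right; exists j.
move=> [->|[i _ <-]].
  by exists ord0 => //; rewrite /env_cons unlift_none.
by exists (lift ord0 i) => //; rewrite /env_cons liftK.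
Qed.

Lemma env_cons_rel n P (a b : X) (e e' : 'I_n -> X) : P a b ->
  (forall i, P (e i) (e' i)) -> forall i, P (env_cons a e i) (env_cons b e' i).
Proof. by move=> Pab Pe i; rewrite /env_cons; case: unliftP => [j _|_] /=. Qed.

(** The threshold [r.*2.+1] separates near from far: the [r]-ball of a near [a] stays within the old
    radius [r + r.*2.+1], while the [r]-ball of a far [a] neither meets nor touches the
    [r]-neighbourhood of the pebbles. *)
Lemma local_iso_step r L M S S' n (e e' : 'I_n -> X) a :
  local_iso (r + r.*2.+1) S S' e e' -> S a ->
  (D.+1 ^ r <= L)%N -> (n * D.+1 ^ r <= M)%N -> rich ('I_M.+1 * 'I_L)%type S' ->
  exists2 b, S' b & local_iso r S S' (env_cons a e) (env_cons b e').
Proof.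
move=> [P [isoP [dS dS'] Pe eP e'P]] Sa rL rM rich'.
have [P1 P2 P3] := isoP.
have [near|far] := pselect (nbs S r.*2.+1 (range e) a).
  have [||||matchP _] := @nbs_matches _ _ P S S' (range e) (range e') r.*2.+1 isoP dS dS'.
  - by apply: subset_trans eP; apply: nbs_leq; exact: leq_addl.
  - by apply: subset_trans e'P; apply: nbs_leq; exact: leq_addl.
  - by move=> _ [i _ <-]; exists (e' i) => //; exists i.
  - by move=> _ [i _ <-]; exists (e i) => //; exists i.
  have [b nearb Pab] := matchP _ near.
  exists b; first by apply: dS'; exists a.
  exists P; split=> //; first exact: env_cons_rel.
    apply: subset_trans eP; rewrite nbsD range_env_cons; apply: nbs_mono.
    by move=> x [->//|/(nbs_extensive)]; apply.
  apply: subset_trans e'P; rewrite nbsD range_env_cons; apply: nbs_mono.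
  by move=> x [->//|/(nbs_extensive)]; apply.
have bounded1 (x : X) : bounded_by [set x] 1.
  by exists [:: (x : {classic X})]; split=> // y ->; rewrite inE.
have [h hE] : exists h : 'I_L -> X, range h = nbs S r [set a].
  apply: (@bounded_by_enum _ _ _ a); last exact: nbs_extensive.
  by apply: bounded_by_leq rL _; rewrite -[(_ ^ _)%N]mul1n; apply: nbs_bounded.
have [H [hH Hdisj]] := alike_copies degree_le dup h.
(* Richness is applied to [M.+1] separated copies of the ball as a single tuple, so that their
   images in [S'] are jointly isolated and also record the separation. *)
have [H' [HH' H'S' H'iso]] := rich' (fun ui => H (val ui.1) ui.2).
have [HH'1 HH'2] := HH'.
have H'inj u v i j : H' (u, i) = H' (v, j) -> u = v.
  move=> /HH'1 /= uv; apply: val_inj; apply: (Hdisj _ _ (H (val u) i)); left.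
    by exists i.
  by rewrite uv; exists j.
(* By isolation the witnessing tuple lies in the range of [H'], so [alike] pulls it back to the
   copies [H] in [X], whose closed neighbourhoods are disjoint. *)
have H'adj u v i j : adjacent_in S' (H' (u, i)) (H' (v, j)) -> u = v.
  move=> [q [z [zq S'z zu zv]]].
  have /choice [w zw] : forall t, exists ui, z t = H' ui.
    move=> t; have [ui _ <-] : range H' (z t); last by exists ui.
    apply: (H'iso (H' (u, i))); first by exists (u, i).
    by exists q, z; split.
  have zE : z = H' \o w by apply/funext.
  move: zq; rewrite zE => /HH'2 zq.
  apply: val_inj; apply: (Hdisj _ _ (H (val u) i)); first by left; exists i.
  right; exists (H (val v) j); first by exists j.
  exists q, ((fun ui => H (val ui.1) ui.2) \o w); split=> //.
    case: zv => t _; rewrite zw => wt; exists t => //=.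
    exact/(HH'1 (w t) (v, j)).
  case: zu => t _; rewrite zw => wt; exists t => //=.
  exact/(HH'1 (w t) (u, i)).
(* The [r]-neighbourhood of the old pebbles has at most [M] points, so one of the [M.+1] copies
   misses it. *)
have [||u uavoid] := @bounded_by_avoid _ (nbs S' r (range e')) M
  (fun u => range (fun i => H' (u, i))).
- apply: bounded_by_leq rM _; apply: nbs_bounded => //.
  by have := bounded_by_range e'; rewrite card_ord.
- by move=> u v _ [i _ <-] [j _ /esym/H'inj].
pose h' i := H' (u, i).
have hh' : alike h h'.
  apply: alike_trans (hH (val u)) _; exact: (alike_comp (fun i => (u, i)) HH').
have h'S' i : S' (h' i) by apply: H'S'; exists (u, i).
have h'iso : isolated_in S' (range h').
  move=> _ y [i _ <-] iy.
  have [[v j] _ yE] : range H' y by apply: H'iso iy; exists (u, i).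
  move: iy; rewrite -yE => /H'adj <-; by exists j.
have h'avoid y : nbs S' r (range e') y -> range h' y -> False.
  by move=> ey uy; apply: (uavoid y).
have [ia _ iaE] : range h a by rewrite hE; apply: nbs_extensive.
(* Otherwise [r] steps from the pebbles to [x], at most one to [y] and [r] more to [a] would make
   [a] near. *)
have far' x y : nbs S r (range e) x -> range h y -> x = y \/ adjacent_in S x y -> False.
  rewrite hE => ex /nbs_sym ya xy; apply: far.
  have -> : r.*2.+1 = (r + r.+1)%N by rewrite addnS addnn.
  rewrite nbsD; apply: nbs_mono ya => _ ->.
  by case: xy => [<-|xy]; [left|right; exists x].
have [||||m1 m2] := @nbs_matches _ _ P S S' (range e) (range e') r isoP dS dS'.
- by apply: subset_trans eP; apply: nbs_leq; exact: leq_addr.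
- by apply: subset_trans e'P; apply: nbs_leq; exact: leq_addr.
- by move=> _ [i _ <-]; exists (e' i) => //; exists i.
- by move=> _ [i _ <-]; exists (e i) => //; exists i.
(* [P] is cut down to radius [r] on both sides, because its outer part may touch the ball of [a] or
   its copy. *)
pose P0 x y := [/\ P x y, nbs S r (range e) x & nbs S' r (range e') y].
pose Q x y := P0 x y \/ graph h h' x y.
have [G1 G2 G3] := alike_partial_iso hh'.
have hS i : S (h i).
  have : range h (h i) by exists i.
  by rewrite hE; apply: nbs_subset => _ ->.
have QS x y : Q x y -> S x.
  by move=> [[Pxy _ _]|[i [-> _]]//]; apply: dS; exists y.
have QS' x y : Q x y -> S' y.
  by move=> [[Pxy _ _]|[i [_ ->]]//]; apply: dS'; exists x.
have P0_graph x y x' y' : P0 x y -> graph h h' x' y' ->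
    ~ (x = x' \/ adjacent_in S x x') /\ ~ (y = y' \/ adjacent_in S' y' y).
  move=> [_ ex ey] [i [-> ->]]; split=> [|yi].
    by apply: far' => //; exists i.
  apply: (h'avoid y) => //; case: yi => [->|iy]; first by exists i.
  by apply: (h'iso (h' i)) => //; exists i.
exists (h' ia) => //.
exists Q; split.
- split.
  + move=> x y y' [p [p'|g']|g [p'|g']].
    * by case: p p' => [p _ _] [p' _ _]; apply: P1 p p'.
    * by have [[]] := P0_graph _ _ _ _ p g'; left.
    * by have [[]] := P0_graph _ _ _ _ p' g; left.
    * exact: G1 g g'.
  + move=> x x' y [p [p'|g']|g [p'|g']].
    * by case: p p' => [p _ _] [p' _ _]; apply: P2 p p'.
    * by have [_ []] := P0_graph _ _ _ _ p g'; left.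
    * by have [_ []] := P0_graph _ _ _ _ p' g; left.
    * exact: G2 g g'.
  (* A related tuple with entries in both parts of [Q] would give an adjacency between the parts,
     which [P0_graph] excludes on either side; so the tuple lies in one part. *)
  + move=> q z z' zQ.
    have zS i : S (z i) by exact: QS (zQ i).
    have zS' i : S' (z' i) by exact: QS' (zQ i).
    have [[i iP]|nP] := pselect (exists i, P0 (z i) (z' i)); last first.
      by apply: G3 => i; case: (zQ i) => // iP; case: nP; exists i.
    have [[j jg]|ng] := pselect (exists j, graph h h' (z j) (z' j)); last first.
      apply: P3 => j; case: (zQ j) => [[]//|jg]; by case: ng; exists j.
    have [nz nz'] := P0_graph _ _ _ _ iP jg.
    split=> [zq|zq']; first by case: nz; right; exists q, z.
    by case: nz'; right; exists q, z'.
- by split=> [x [y]|y [x]]; [exact: QS|exact: QS'].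
- apply: env_cons_rel; first by right; exists ia; rewrite iaE.
  by move=> i; left; split=> //; apply: nbs_extensive; exists i.
- rewrite range_env_cons nbsU => x [|ex].
    by rewrite -hE => -[i _ <-]; exists (h' i); right; exists i.
  by have [y ey Pxy] := m1 _ ex; exists y; left.
- rewrite range_env_cons nbsU => y [hy|ey].
    have [i _ <-] : range h' y.
      apply: (@isolated_nbs _ _ S' _ r h'iso).
      by apply: nbs_mono hy => _ ->; exists ia.
    by exists (h i); right; exists i.
  by have [x ex Pxy] := m2 _ ey; exists x; left.
Qed.

End Game.

(** * Elementary equivalence of rich sets up to quantifier depth *)

Fixpoint quantifier_depth (Y : vocabulary) n (f : formula Y n) : nat :=
  match f with
  | FEq _ _ _ => 0
  | FRel _ _ _ => 0
  | FNot _ f1 => quantifier_depth f1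
  | FAnd _ f1 f2 => maxn (quantifier_depth f1) (quantifier_depth f2)
  | FOr _ f1 f2 => maxn (quantifier_depth f1) (quantifier_depth f2)
  | FImp _ f1 f2 => maxn (quantifier_depth f1) (quantifier_depth f2)
  | FAll _ f1 => (quantifier_depth f1).+1
  | FEx _ f1 => (quantifier_depth f1).+1
  end.

(* Radius of the neighbourhoods on which the two positions agree when [j]
   rounds remain. *)
Definition radius j := iter j (fun r => r + r.*2.+1)%N 0%N.

(* [radius j]-balls have at most [D.+1 ^ radius j] elements; one copy more than
   the size of the neighbourhood of [k] pebbles leaves a copy far from them. *)
Definition pattern D k j : finType :=
  ('I_(k * D.+1 ^ radius j).+1 * 'I_(D.+1 ^ radius j))%type.

Section Elementary.
Variables (Y : vocabulary) (X : structure Y) (D : nat).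
Hypothesis degree_le : forall x : X, bounded_by [set y | gaifman x y] D.
Hypothesis dup : duplicate_substructure X.

(** The invariant [n + j <= k] adds pebbles placed to rounds left. It keeps the number of pebbles at
    most [k], so the copies in [pattern D k i] suffice in every round. *)
Lemma holds_local_iso n (f : formula Y n) k j S S'
    (e : 'I_n -> substructure S) (e' : 'I_n -> substructure S') :
  (quantifier_depth f <= j)%N -> (n + j <= k)%N ->
  (forall i, (i < k)%N -> rich (pattern D k i) S) ->
  (forall i, (i < k)%N -> rich (pattern D k i) S') ->
  local_iso (radius j) S S' (val \o e : 'I_n -> X) (val \o e') ->
  holds f e <-> holds f e'.
Proof.
have step m i (U U' : set X) (d : 'I_m -> substructure U)
    (d' : 'I_m -> substructure U') (a : substructure U) :
    (m + i.+1 <= k)%N -> rich (pattern D k i) U' ->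
    local_iso (radius i.+1) U U' (val \o d : 'I_m -> X) (val \o d') ->
    exists b : substructure U', local_iso (radius i) U U'
      (val \o env_cons a d : 'I_m.+1 -> X) (val \o env_cons b d').
  move=> mk richU' dd'.
  have [|b U'b bP] := local_iso_step degree_le dup dd' (set_valP a) (leqnn _) _ richU'.
    by rewrite leq_mul2r (leq_trans (leq_addr _ _) mk) orbT.
  have valE V p (c : substructure V) (g : 'I_p -> substructure V) :
      (val \o env_cons c g : _ -> X) = env_cons (val c) (val \o g).
    by apply/funext => t; rewrite /env_cons /=; case: unliftP.
  by exists (SigSub (mem_set U'b)); rewrite !valE.
elim: f j S S' e e' => {n} [n u v|n r v|n f1 IH|n f1 IH1 f2 IH2|n f1 IH1 f2 IH2|
  n f1 IH1 f2 IH2|n f1 IH|n f1 IH] j S S' e e' /=.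
- move=> _ _ _ _ [P [[P1 P2 _] _ Pe _ _]]; split=> uv; apply: val_inj.
    by apply: P1 (Pe u) _; rewrite /= uv; apply: Pe.
  by apply: P2 (Pe u) _; rewrite /= uv; apply: Pe.
- by move=> _ _ _ _ [P [[_ _ P3] _ Pe _ _]]; apply: P3 => i; apply: Pe.
- by move=> fj nj rS rS' /(IH _ _ _ _ _ fj nj rS rS') ->.
- rewrite geq_max => /andP[f1j f2j] nj rS rS' ee'.
  by rewrite (IH1 _ _ _ _ _ f1j nj rS rS' ee') (IH2 _ _ _ _ _ f2j nj rS rS' ee').
- rewrite geq_max => /andP[f1j f2j] nj rS rS' ee'.
  by rewrite (IH1 _ _ _ _ _ f1j nj rS rS' ee') (IH2 _ _ _ _ _ f2j nj rS rS' ee').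
- rewrite geq_max => /andP[f1j f2j] nj rS rS' ee'.
  by rewrite (IH1 _ _ _ _ _ f1j nj rS rS' ee') (IH2 _ _ _ _ _ f2j nj rS rS' ee').
- case: j => // j fj nj rS rS' ee'.
  have jk : (j < k)%N by rewrite (leq_trans _ nj) // leq_addl.
  have nj' : (n.+1 + j <= k)%N by rewrite addSnnS.
  split=> fall b.
    have [a ba] := step _ _ _ _ _ _ b nj (rS _ jk) (local_iso_sym ee').
    exact/(IH _ _ _ _ _ fj nj' rS rS' (local_iso_sym ba)).
  have [a ba] := step _ _ _ _ _ _ b nj (rS' _ jk) ee'.
  exact/(IH _ _ _ _ _ fj nj' rS rS' ba).
- case: j => // j fj nj rS rS' ee'.
  have jk : (j < k)%N by rewrite (leq_trans _ nj) // leq_addl.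
  have nj' : (n.+1 + j <= k)%N by rewrite addSnnS.
  split=> -[b fb].
    have [a ba] := step _ _ _ _ _ _ b nj (rS' _ jk) ee'.
    by exists a; apply/(IH _ _ _ _ _ fj nj' rS rS' ba).
  have [a ba] := step _ _ _ _ _ _ b nj (rS _ jk) (local_iso_sym ee').
  by exists a; apply/(IH _ _ _ _ _ fj nj' rS rS' (local_iso_sym ba)).
Qed.

(** The game starts without pebbles; neighbourhoods of the empty set are empty, so the empty
    relation is a local isomorphism of every radius. *)
Lemma models_rich (phi : sentence Y) (k := quantifier_depth phi)
    (S S' : set X) :
  (forall i, (i < k)%N -> rich (pattern D k i) S) ->
  (forall i, (i < k)%N -> rich (pattern D k i) S') ->
  models (substructure S) phi <-> models (substructure S') phi.
Proof.
move=> rS rS'; apply: (@holds_local_iso _ _ k k) => //.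
have range0 A (h : 'I_0 -> A) : range h = set0 by rewrite -subset0 => x [[]].
exists (fun _ _ => False); split=> [|||x|x]; last 2 first.
- by rewrite range0 nbs0.
- by rewrite range0 nbs0.
(* Only nullary symbols remain here, and the empty tuple is unique. *)
- split=> // r z z' zz'.
  by have -> : z = z' by apply/funext => i; case: (zz' i).
- by split=> x [].
- by case.
Qed.

End Elementary.

(** * Counting subsets with prescribed traces *)

Section Counting.
Implicit Types (T U V : choiceType) (W : finType).

Definition count_set T (A : set T) : nat := #|` fset_set A|.

Lemma count_set_sub T (A B : set T) : finite_set B -> A `<=` B ->
  (count_set A <= count_set B)%N.
Proof.
move=> fB AB; apply: fsubset_leq_card; rewrite -fset_set_sub //.
exact: sub_finite_set fB.
Qed.

Lemma count_setU T (A B : set T) : finite_set A -> finite_set B ->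
  (count_set (A `|` B) <= count_set A + count_set B)%N.
Proof. by move=> fA fB; rewrite /count_set fset_setU // cardfsU leq_subr. Qed.

Lemma count_setD T (A B : set T) : finite_set A -> B `<=` A ->
  count_set (A `\` B) = (count_set A - count_set B)%N.
Proof.
move=> fA BA; have fB := sub_finite_set BA fA.
by rewrite /count_set fset_setD // cardfsDS // -fset_set_sub.
Qed.

Lemma count_set_inj U V W (A : set U) (B : set V) (f : U -> V * W) :
  finite_set A -> finite_set B -> (forall x, A x -> B (f x).1) ->
  (forall x y, A x -> A y -> f x = f y -> x = y) ->
  (count_set A <= count_set B * #|W|)%N.
Proof.
move=> fA fB fAB finj; rewrite /count_set cardE -(size_map f (fset_set A)).
rewrite -(size_allpairs (@pair V W)).
apply: uniq_leq_size.
  rewrite map_inj_in_uniq ?fset_uniq // => x y.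
  by rewrite !in_fset_set // !inE; apply: finj.
move=> _ /mapP[x xA ->]; apply/allpairsP; exists (f x); split.
- by rewrite in_fset_set // inE; apply: fAB; move: xA; rewrite in_fset_set // inE.
- by rewrite mem_enum.
- by case: (f x).
Qed.

Variable X : Type.
Implicit Types (B N F S : set X) (Q : set (set X)).

Definition subsets B : set (set X) := [set S | S `<=` B].

(** The code of [S] is its preimage under an enumeration of [A], possibly with repetitions. *)
Lemma bounded_by_subsets A n : bounded_by A n ->
  exists phi : set X -> {set 'I_n}, forall S S', S `<=` A -> S' `<=` A ->
    phi S = phi S' -> S = S'.
Proof.
move=> An; have [->|/set0P[x Ax]] := eqVneq A set0.
  by exists (fun _ => finset.set0) => S S'; rewrite !subset0 => S0 S'0 _; rewrite S0.
have [h hA] := bounded_by_enum An Ax.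
exists (fun S => [set i | `[< S (h i) >]]%SET) => S S' SA S'A /setP eqS.
have hS i : S (h i) <-> S' (h i).
  have := eqS i; rewrite /= !inE => SS'.
  by split=> /asboolP; [rewrite SS'|rewrite -SS'] => /asboolP.
have hP y : A y -> exists i, h i = y by rewrite -hA => -[i _ <-]; exists i.
apply/seteqP; split=> y Sy.
  by have [i iy] := hP _ (SA _ Sy); move: Sy; rewrite -iy => /hS.
by have [i iy] := hP _ (S'A _ Sy); move: Sy; rewrite -iy => /hS.
Qed.

Lemma subsets_finite B : finite_set B -> finite_set (subsets B).
Proof.
move=> /finite_bounded_by[n Bn].
have [->|/set0P[x Bx]] := eqVneq B set0.
  apply: (@sub_finite_set _ _ [set set0]) => [S|]; last exact: finite_set1.
  by rewrite /subsets /= subset0.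
have [h hB] := bounded_by_enum Bn Bx.
pose g (t : {set 'I_n}) : set X := [set h i | i in [set` t]].
apply: sub_finite_set (bounded_by_finite (bounded_by_range g)) => S SB.
exists [set i | `[< S (h i) >]]%SET => //.
apply/seteqP; split=> [_ [i /= + <-]|y Sy]; first by rewrite inE => /asboolP.
have [i _ iy] : range h y by rewrite hB; exact: SB.
by exists i => //=; rewrite inE iy; apply/asboolP.
Qed.

(* Resetting the trace on [N] to [F] is at most [2 ^ k]-to-one. *)
Lemma count_set_trace B N F k Q : finite_set B -> Q `<=` subsets B ->
  F `<=` N -> bounded_by N k -> (forall S, Q S -> Q ((S `\` N) `|` F)) ->
  (count_set (Q `&` [set S | S `&` N <> F]) * 2 ^ k <=
   count_set Q * (2 ^ k).-1)%N.
Proof.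
move=> fB QB FN Nk Qreset.
have fQ : finite_set Q := sub_finite_set QB (subsets_finite fB).
pose Q1 := Q `&` [set S | S `&` N = F].
have Q1Q : Q1 `<=` Q by move=> S [].
have [phi phi_inj] := bounded_by_subsets Nk.
have QQ1 : (count_set Q <= count_set Q1 * 2 ^ k)%N.
  have -> : (2 ^ k = #|{set 'I_k}|)%N
    by rewrite -cardsT -finset.powersetT card_powerset cardsT card_ord.
  (* The reset set determines [S] outside [N], and the code of the trace determines it inside. *)
  apply: (@count_set_inj _ _ _ _ _ (fun S => ((S `\` N) `|` F, phi (S `&` N)))) => //.
  - exact: sub_finite_set fQ.
  - move=> S QS; split; first exact: Qreset.
    apply/seteqP; split=> [x [[[]|]]//|x Fx].
    by split; [right|exact: FN].
  - move=> S S' _ _ [eqD /phi_inj eqI].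
    rewrite -(setUIDK S N) -(setUIDK S' N) eqI //; congr (_ `|` _).
    have DN (U : set X) : (U `\` N `|` F) `\` N = U `\` N.
      rewrite setDUl setDDl setUid (_ : F `\` N = set0) ?setU0 //.
      by rewrite setD_eq0.
    by rewrite -(DN S) eqD DN.
have -> : Q `&` [set S | S `&` N <> F] = Q `\` Q1.
  by apply/seteqP; split=> S [QS SN]; split=> //; [case|move=> ?; apply: SN].
rewrite count_setD // mulnBl -subn1 mulnBr muln1.
exact: leq_sub2l.
Qed.

(** Independence in counting form: as the [N i] are disjoint, resetting on [N m] keeps the earlier
    traces, so each further condition costs a factor [(2 ^ k).-1 / 2 ^ k]. *)
Lemma count_set_traces B (N F : nat -> set X) k m : finite_set B ->
  (forall i, (i < m)%N -> N i `<=` B) -> (forall i, F i `<=` N i) ->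
  (forall i, bounded_by (N i) k) -> (forall i j x, N i x -> N j x -> i = j) ->
  (count_set (subsets B `&` [set S | forall i, (i < m)%N -> S `&` N i <> F i])
     * (2 ^ k) ^ m <= count_set (subsets B) * (2 ^ k).-1 ^ m)%N.
Proof.
move=> fB + FN Nk Ndisj; elim: m => [|m IH] NB.
  rewrite !expn0 !muln1 count_set_sub //; exact: subsets_finite.
set Q := subsets B `&` [set S | forall i, (i < m)%N -> S `&` N i <> F i] in IH.
have -> : subsets B `&` [set S | forall i, (i < m.+1)%N -> S `&` N i <> F i] =
    Q `&` [set S | S `&` N m <> F m].
  apply/seteqP; split=> S.
    by move=> [SB SN]; split; [split=> // i im; apply: SN; exact: ltnW|exact: SN].
  move=> [[SB SN] SNm]; split=> // i; rewrite ltnS leq_eqVlt.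
  by move=> /predU1P[->//|]; exact: SN.
rewrite !expnS mulnA.
have QB : Q `<=` subsets B by move=> S [].
have reset S : Q S -> Q ((S `\` N m) `|` F m).
  move=> [SB SN]; split.
    by move=> x [[/SB]//|/FN]; apply: NB.
  move=> i im; rewrite (_ : _ `&` N i = S `&` N i); first exact: SN.
  apply/seteqP; split=> x.
    move=> [[[Sx nx]|/FN mx] ix]; first by split.
    by move: im; rewrite (Ndisj _ _ _ ix mx) ltnn.
  move=> [Sx ix]; split=> //; left; split=> // mx.
  by move: im; rewrite (Ndisj _ _ _ ix mx) ltnn.
have := count_set_trace fB QB (FN m) (Nk m) reset.
move=> /(leq_mul (leqnn ((2 ^ k) ^ m))) QN.
rewrite mulnC (leq_trans QN) // [leqRHS]mulnCA mulnA mulnC leq_mul //.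
by rewrite mulnC IH // => i im; apply: NB; exact: ltnW.
Qed.

End Counting.

(** * Balls are finite and exhaust the structure *)

Section Balls.
Variables (Y : vocabulary) (X : structure Y).

Lemma gball_nbs n (x : X) : gball n x `<=` nbs setT n [set x].
Proof.
move=> y; rewrite /gball /distance /=; case: pselect => // w.
case: ex_minnP => d /asboolP[p [xp py pd]] _ dn.
suff : nbs setT d [set x] y by apply: nbs_leq.
rewrite -pd -py {d dn pd w py y}; elim: p x xp => [|y p IH] x //=.
move=> /andP[/asboolP[_ [r [z [zr zx zy]]]] /IH].
(* The path is consumed from its start, so the extra step is moved to the innermost place of the
   iteration. *)
move=> yp; suff : nbs setT (size p) (nb setT [set x]) (last y p) by rewrite /nbs -iterSr.
by apply: nbs_mono yp => _ ->; right; exists x => //; exists r, z.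
Qed.

Lemma gball_finite D : (forall x : X, bounded_by [set y | gaifman x y] D) ->
  forall n (x : X), finite_set (gball n x).
Proof.
move=> degree_le n x; apply: sub_finite_set (@gball_nbs n x) _.
suff : bounded_by (nbs setT n [set x]) (1 * D.+1 ^ n) by apply: bounded_by_finite.
by apply: nbs_bounded => //; exists [:: (x : {classic X})]; split=> // y ->; rewrite inE.
Qed.

Lemma gball_exhaust : connected_structure X ->
  forall x y : X, exists d, forall n, (d <= n)%N -> gball n x y.
Proof.
move=> [C CE] x y.
have component_eq z : component z = C.
  by have : range (@component Y X) (component z) by [exists z]; rewrite CE.
have xy : exists n, walk x y n.
  have : component y y by exists 0%N, [::].
  by rewrite component_eq -(component_eq x).
have [d dE] : exists d, distance x y = Some d.
  by rewrite /distance; case: pselect => // w; eexists.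
by exists d => n dn; rewrite /gball /= dE.
Qed.

End Balls.

Lemma bounded_degree_bounded_by (Y : vocabulary) (X : structure Y) :
  bounded_degree X -> exists D, forall x : X, bounded_by [set y | gaifman x y] D.
Proof.
move=> [D deg]; exists D => x.
pose A : set {classic X} := [set y | gaifman x y].
have Afin : finite_set A by apply/finite_set_leP; exists D; apply: deg.
exists (fset_set A); split; first exact: (@geq_card_fset_set {classic X} A D (deg x)).
by move=> y xy; rewrite in_fset_set // inE.
Qed.

(** * Properties of almost all subsets of large balls *)

Section AlmostAll.
Variables (R : realType) (Y : vocabulary) (X : structure Y) (D : nat).
Hypothesis degree_le : forall x : X, bounded_by [set y | gaifman x y] D.
Hypothesis connX : connected_structure X.
Hypothesis dup : duplicate_substructure X.
Implicit Types (Q : set X -> Prop).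

Let finite_subsets n (x : X) : finite_set (subsets (gball n x)).
Proof. exact/subsets_finite/gball_finite. Qed.

Let count_subsets_gt0 n (x : X) : (0 < (count_set (subsets (gball n x)))%:R :> R)%R.
Proof.
rewrite ltr0n cardfs_gt0; apply/eqP => /fset_set_set0.
move=> /(_ (finite_subsets _ _)) s0; have : subsets (gball n x) set0 by [].
by rewrite s0.
Qed.

(** The fraction of exceptions tends to 0, written without division so that it can be compared
    directly with cardinalities. *)
Definition almost_all Q := forall (x : X) (eps : R), (0 < eps)%R ->
  exists n0, forall n, (n0 <= n)%N ->
    ((count_set [set S | S `<=` gball n x /\ ~ Q S])%:R <=
     eps * (count_set (subsets (gball n x)))%:R)%R.

Lemma almost_all_sub Q Q' : (forall S, Q S -> Q' S) -> almost_all Q -> almost_all Q'.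
Proof.
move=> QQ' aQ x eps /(aQ x)[n0 n0P]; exists n0 => n /n0P; apply: le_trans.
rewrite ler_nat; apply: count_set_sub => [|S [SB nQ]].
  by apply: sub_finite_set (finite_subsets n x) => S [].
by split=> // /QQ'.
Qed.

Lemma almost_all_and Q Q' : almost_all Q -> almost_all Q' ->
  almost_all (fun S => Q S /\ Q' S).
Proof.
move=> aQ aQ' x eps eps0; have e2 : (0 < eps / 2)%R by rewrite divr_gt0.
have [n0 n0P] := aQ x _ e2; have [n1 n1P] := aQ' x _ e2.
exists (maxn n0 n1) => n; rewrite geq_max => /andP[/n0P Qn /n1P Q'n].
rewrite (splitr eps) mulrDl; apply: le_trans (lerD Qn Q'n).
rewrite -natrD ler_nat.
have fin Q0 : finite_set [set S | S `<=` gball n x /\ ~ Q0 S].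
  by apply: sub_finite_set (finite_subsets n x) => S [].
apply: leq_trans (count_setU (fin _) (fin _)); apply: count_set_sub.
  by rewrite finite_setU.
by move=> S [SB /not_andP[nQ|nQ]]; [left|right].
Qed.

Lemma almost_all_true Q : (forall S, Q S) -> almost_all Q.
Proof.
move=> allQ x eps eps0; exists 0%N => n _.
rewrite (_ : [set S | _] = set0); last by rewrite -subset0 => S [_]; apply.
by rewrite /count_set fset_set0 cardfs0 mulr_ge0 // ltW.
Qed.

Lemma almost_all_forall (C : finType) (Q : C -> set X -> Prop) :
  (forall c, almost_all (Q c)) -> almost_all (fun S => forall c, Q c S).
Proof.
move=> aQ; suff : almost_all (fun S => forall c, c \in enum C -> Q c S).
  by apply: almost_all_sub => S QS c; apply: QS; rewrite mem_enum.
elim: (enum C) => [|c s IH]; first exact: almost_all_true.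
apply: almost_all_sub (almost_all_and (aQ c) IH) => S [QcS QsS] c'.
by rewrite inE => /predU1P[->|/QsS].
Qed.

Lemma expr_lt1_small (q eps : R) : (0 <= q < 1)%R -> (0 < eps)%R ->
  exists m, (q ^+ m <= eps)%R.
Proof.
move=> /andP[q0 q1] eps0.
have /cvgrPdist_le/(_ _ eps0)[m _ mP] : (q ^+ n)%R @[n --> \oo] --> (0 : R)%R.
  by apply: cvg_expr; rewrite ger0_norm.
exists m; have := mP m (leqnn m).
by rewrite /= sub0r normrN ger0_norm // exprn_ge0.
Qed.

(** A set without an isolated copy has the wrong trace on the neighbourhood of each of [m] separated
    copies. Such sets make up at most the fraction [q ^+ m] of a ball containing these
    neighbourhoods, and [m] is chosen to make this at most [eps]. *)
Lemma almost_all_alike (I : finType) (h : I -> X) :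
  almost_all (fun S => exists h' : I -> X,
    [/\ alike h h', range h' `<=` S & isolated_in S (range h')]).
Proof.
move=> x eps eps0.
have [H [hH Hdisj]] := alike_copies degree_le dup h.
pose k := (#|I| * D.+1)%N.
have Nk i : bounded_by (nb setT (range (H i))) k.
  exact/nb_bounded/bounded_by_range.
have C0 : (0 < 2 ^ k)%N by rewrite expn_gt0.
pose q : R := ((2 ^ k).-1%:R / (2 ^ k)%:R)%R.
have [||m qm] := @expr_lt1_small q eps => //.
  by rewrite divr_ge0 //= ltr_pdivrMr ?ltr0n // mul1r ltr_nat prednK.
have [d dP] : exists d, forall n i, (d <= n)%N -> (i < m)%N ->
    nb setT (range (H i)) `<=` gball n x.
  have cover (s : seq {classic X}) : exists d, forall n, (d <= n)%N ->
      forall y, y \in s -> gball n x y.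
    elim: s => [|y s [d dP]]; first by exists 0%N.
    have [d' d'P] := gball_exhaust connX x y.
    exists (maxn d d') => n; rewrite geq_max => /andP[dn d'n] w.
    by rewrite inE => /predU1P[->|]; [exact: d'P|exact: dP].
  elim: m {qm} => [|m [d dP]]; first by exists 0%N.
  have [s [_ sP]] := Nk m; have [d' d'P] := cover s.
  exists (maxn d d') => n i; rewrite geq_max => /andP[dn d'n].
  rewrite ltnS leq_eqVlt => /predU1P[->|im]; last exact: dP.
  by move=> y /sP; apply: d'P.
exists d => n dn.
have FN i : range (H i) `<=` nb setT (range (H i)) by left.
have := count_set_traces (gball_finite degree_le n x) (fun i => dP n i dn) FN Nk Hdisj.
set bad' := _ `&` _ => badm.
apply: (@le_trans _ _ ((count_set bad')%:R : R)%R).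
  (* If the trace of [S] on the closed neighbourhood of a copy is the copy itself, any neighbour in
     [S] of the copy belongs to it, so the copy is isolated. *)
  rewrite ler_nat; apply: count_set_sub.
    by apply: sub_finite_set (finite_subsets n x) => S [].
  move=> S [SB noS]; split=> // i im SN; apply: noS; exists (H i); split=> //.
    by move=> y; rewrite -SN => -[].
  move=> y w iy yw; rewrite -SN; split; first exact: adjacent_in_mem yw.
  by right; exists y => //; exact: adjacent_in_setT yw.
apply: (@le_trans _ _ (q ^+ m * (count_set (subsets (gball n x)))%:R)%R); last first.
  by rewrite ler_pM2r.
rewrite /q expr_div_n mulrAC ler_pdivlMr ?exprn_gt0 ?ltr0n //.
by rewrite -!natrX -!natrM ler_nat [leqRHS]mulnC.
Qed.

(** There may be infinitely many tuples, but the vocabulary is finite, so there are finitely many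
    atomic types [code h]; one representative of each realized type is enough. *)
Lemma almost_all_rich (I : finType) : almost_all (@rich Y X I).
Proof.
pose code (h : I -> X) := ([ffun ij : I * I => `[< h ij.1 = h ij.2 >]],
  [ffun rw : {r : Y & {ffun 'I_(arity r) -> I}} =>
     `[< interp (fun i => h (tagged rw i)) >]]).
have codeP h h' : code h = code h' -> alike h h'.
  move=> [/ffunP eqh /ffunP inth]; split=> [i j|r w].
    have := eqh (i, j); rewrite !ffunE /= => E.
    by split=> /asboolP; [rewrite E|rewrite -E] => /asboolP.
  have := inth (Tagged _ (finfun w)); rewrite !ffunE /=.
  have fwE (g : I -> X) : (fun i => g (finfun w i)) = g \o w.
    by apply/funext => i; rewrite /= ffunE.
  rewrite !fwE => E.
  by split=> /asboolP; [rewrite E|rewrite -E] => /asboolP.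
pose Q c S := forall h, code h = c -> exists h' : I -> X,
    [/\ alike h h', range h' `<=` S & isolated_in S (range h')].
suff : almost_all (fun S => forall c, Q c S).
  by apply: almost_all_sub => S QS h; apply: QS.
apply: almost_all_forall => c.
have [[h hc]|noh] := pselect (exists h, code h = c); last first.
  by apply: almost_all_true => S h hc; case: noh; exists h.
apply: almost_all_sub (almost_all_alike h) => S [h' [hh' ? ?]] g gc.
exists h'; split=> //; apply: alike_trans hh'; apply: codeP.
by rewrite gc hc.
Qed.

Lemma almost_all_surely_true Q (phi : sentence Y) : almost_all Q ->
  (forall S : set X, Q S -> models (substructure S) phi) ->
  almost_surely_true X R phi.
Proof.
move=> aQ Qphi x; apply/cvgrPdist_le => eps eps0.
have [n0 n0P] := aQ x eps eps0; exists n0 => // n /= /n0P.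
rewrite /true_fraction -/(subsets _) -/(count_set (subsets _)).
set T := subsets _; set T1 := [set S | _ /\ models _ _].
have T0 := count_subsets_gt0 n x.
have T1T : T1 `<=` T by move=> S [].
have T1n : (count_set T1 <= count_set T)%N by exact: count_set_sub (finite_subsets n x) T1T.
move=> bad; rewrite -/(count_set T1).
have -> : (1 - (count_set T1)%:R / (count_set T)%:R =
  (count_set T - count_set T1)%:R / (count_set T)%:R :> R)%R.
  by rewrite natrB // mulrBl divff // gt_eqF.
rewrite ger0_norm ?divr_ge0 // ler_pdivrMr //; apply: le_trans bad.
rewrite ler_nat -(count_setD (finite_subsets n x) T1T); apply: count_set_sub.
  by apply: sub_finite_set (finite_subsets n x) => S [].
by move=> S [SB nS]; split=> // /Qphi mS; apply: nS.
Qed.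

Lemma almost_all_surely_false Q (phi : sentence Y) : almost_all Q ->
  (forall S : set X, Q S -> ~ models (substructure S) phi) ->
  almost_surely_false X R phi.
Proof.
move=> aQ Qphi x; apply/cvgrPdist_le => eps eps0.
have [n0 n0P] := aQ x eps eps0; exists n0 => // n /= /n0P.
have T0 := count_subsets_gt0 n x.
move=> bad; rewrite sub0r normrN ger0_norm ?divr_ge0 // ler_pdivrMr //.
apply: le_trans bad; rewrite ler_nat; apply: count_set_sub.
  by apply: sub_finite_set (finite_subsets n x) => S [].
by move=> S [SB mS]; split=> // /Qphi.
Qed.

End AlmostAll.

Theorem theorem3 (R : realType) (Y : vocabulary) (X : structure Y)
    (Xinfinite : infinite_set [set: X]%classic)
    (Xconnected : connected_structure X)
    (Xbounded : bounded_degree X)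
    (Xduplicate : duplicate_substructure X)
    (phi : sentence Y) :
  almost_surely_true X R phi \/ almost_surely_false X R phi.
Proof.
have [D degree_le] := bounded_degree_bounded_by Xbounded.
pose k := quantifier_depth phi.
pose Q (S : set X) := forall i : 'I_k, rich (pattern D k i) S.
have aQ : almost_all R Q.
  by apply: almost_all_forall => // i; exact: almost_all_rich.
have Qphi S S' : Q S -> Q S' -> models (substructure S) phi ->
    models (substructure S') phi.
  move=> QS QS'; apply: (models_rich degree_le Xduplicate _ _).1 => i ik.
    exact: (QS (Ordinal ik)).
  exact: (QS' (Ordinal ik)).
(* Sets satisfying [Q] agree on [phi], so a single one of them decides which alternative holds. *)
have [[S [QS mS]]|noS] := pselect (exists S, Q S /\ models (substructure S) phi).
  by left; apply: almost_all_surely_true aQ _ => // S' QS'; apply: Qphi mS.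
right; apply: almost_all_surely_false aQ _ => // S QS mS.
by apply: noS; exists S.
Qed.
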